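(* Let $G$ and $H$ be undirected simple graphs on $N=\{1,\dots,n\}$. The set $\mathcal M(G,H)$ is connected (in the Euclidean topology) in each of the following cases: (1) for every non-edge $kl$ of $G$ there is at most one path in $H$ connecting $k$ and $l$ (or this holds with $G$ and $H$ exchanged); (2) there is a vertex $i\in N$ such that for all non-edges $kl$ of $G$, every path in $H$ connecting $k$ and $l$ contains $i$ (or this holds with $G$ and $H$ exchanged); (3) $|E_G\cap E_H|\le 3$.
   Context: $E_G$ denotes the edge set of $G$; a non-edge of $G$ is a pair $kl$ of distinct vertices with $kl\notin E_G$. A path traverses no vertex more than once; it contains its endpoints. $\mathrm{PD}_n$ is the set of real symmetric positive definite $n\times n$ matrices. $$\mathcal M(G,H)=\{\Sigma\in\mathrm{PD}_n : (\Sigma^{-1})_{ij}=0 \text{ for all } i\ne j,\ ij\notin E_G;\ \Sigma_{kl}=0\text{ for all } k\neq l,\ kl\notin E_H\}.$$ *)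

(* Defs.v *)
From HB Require Import structures.
From mathcomp Require Import all_boot all_order all_algebra.
From mathcomp Require Import all_classical all_reals all_analysis.

Set Implicit Arguments.
Unset Strict Implicit.
Unset Printing Implicit Defensive.

Import Order.TTheory GRing.Theory Num.Theory.
Import numFieldNormedType.Exports.

Local Open Scope classical_set_scope.
Local Open Scope ring_scope.

Definition simple_graph (T : finType) (G : rel T) : Prop :=
  symmetric G /\ irreflexive G.

(* Unordered edges, so that cardinalities count each edge once. *)
Definition edges (T : finType) (G : rel T) : {set {set T}} :=
  [set [set p.1; p.2] | p : T * T & G p.1 p.2]%SET.

Definition non_edge (T : finType) (G : rel T) (k l : T) : bool :=
  (k != l) && ~~ G k l.

(* [s] is the full vertex sequence, endpoints included, of a path from [k] to
   [l]. For [k != l], orienting a path from [k] to [l] determines [s], so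
   distinct sequences are distinct paths. *)
Definition path_between (T : finType) (G : rel T) (k l : T) (s : seq T) : Prop :=
  exists p : seq T, [/\ s = k :: p, path G k p, last k p = l & uniq s].

Definition at_most_one_path (T : finType) (G H : rel T) : Prop :=
  forall k l : T, non_edge G k l ->
  forall s t : seq T, path_between H k l s -> path_between H k l t -> s = t.

Definition paths_through (T : finType) (G H : rel T) (i : T) : Prop :=
  forall k l : T, non_edge G k l ->
  forall s : seq T, path_between H k l s -> i \in s.

Definition posdef (R : realType) (n : nat) (S : 'M[R]_n) : Prop :=
  S^T = S /\ forall x : 'cV[R]_n, x != 0 -> 0 < (x^T *m S *m x) 0 0.

Definition double_markov (R : realType) (n : nat) (G H : rel 'I_n)
  : set 'M[R]_n :=
  [set S | [/\ posdef S,
     (forall i j : 'I_n, non_edge G i j -> invmx S i j = 0) &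
     (forall k l : 'I_n, non_edge H k l -> S k l = 0)]].

Arguments double_markov R {n} G H.

(* Main.v *)
Require Import Defs.
From HB Require Import structures.
From mathcomp Require Import all_boot all_order all_algebra.
From mathcomp Require Import all_classical all_reals all_analysis.
From mathcomp Require Import ring.
Import Order.TTheory GRing.Theory Num.Theory.
Import numFieldNormedType.Exports.
Local Open Scope classical_set_scope.
Local Open Scope ring_scope.

(** Write K for the inverse of S.  If two vertices are disconnected in the graph
    of the nonzero off-diagonal entries of S, the corresponding entry of K
    vanishes.  Hence, when all non-edges of G are disconnected in that graph,
    the segment from S to the identity stays in the model.

    Case (1): on a unique path of H from k to l every edge is a bridge, and
    positive definiteness propagates K k l = 0 along the path to K l l = 0,
    which is absurd; so k and l are already disconnected in the graph of S.

    Case (2): multiplying the off-diagonal part of row and column i by t in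
    [0, 1] preserves all the vanishing entries of K, and at t = 0 the non-edges
    of G are disconnected.  The exchanged cases follow since inversion is a
    homeomorphism between the models of (G, H) and (H, G).

    Case (3): let F be the intersection of G and H.  For a component B of F, the
    sum of S i j * K i j over i, j in B equals #|B|, which forces S to be block
    diagonal along the components of F.  So G and H may be restricted to these
    components, and a graph F with at most three edges then always falls under
    case (2), possibly exchanged. *)

Set Implicit Arguments.
Unset Strict Implicit.
Unset Printing Implicit Defensive.

(** * Continuity of inversion and connectedness of sets of matrices *)

Section MatrixContinuity.
Variable R : realType.

Lemma cvg_mx_entries (U : Type) (F : set_system U) (FF : Filter F) m n
    (f : U -> 'M[R]_(m, n)) (M : 'M[R]_(m, n)) :
  (forall i j, f x i j @[x --> F] --> M i j) -> f @ F --> M.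
Proof.
move=> cvf A [P nP sPA]; apply: (@filterS _ F FF _ _ (fun x => sPA (f x))).
by apply: filter_forall => i; apply: filter_forall => j; exact: cvf (nP i j).
Qed.

Lemma cvg_bigsum (U : Type) (F : set_system U) (FF : Filter F) (I : Type)
    (r : seq I) (P : pred I) (f : I -> U -> R) (a : I -> R) :
  (forall i, f i @ F --> a i) ->
  \sum_(i <- r | P i) f i x @[x --> F] --> \sum_(i <- r | P i) a i.
Proof.
move=> fa; elim: r => [|i r IHr].
  by rewrite big_nil; under eq_fun do rewrite big_nil; exact: cvg_cst.
rewrite big_cons; under eq_fun do rewrite big_cons.
by case: (P i) => //; apply: cvgD.
Qed.

Lemma cvg_bigprod (U : Type) (F : set_system U) (FF : Filter F) (I : Type)
    (r : seq I) (P : pred I) (f : I -> U -> R) (a : I -> R) :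
  (forall i, f i @ F --> a i) ->
  \prod_(i <- r | P i) f i x @[x --> F] --> \prod_(i <- r | P i) a i.
Proof.
move=> fa; elim: r => [|i r IHr].
  by rewrite big_nil; under eq_fun do rewrite big_nil; exact: cvg_cst.
rewrite big_cons; under eq_fun do rewrite big_cons.
by case: (P i) => //; apply: cvgM.
Qed.

Lemma cvg_det (U : Type) (F : set_system U) (FF : Filter F) n
    (f : U -> 'M[R]_n) (M : 'M[R]_n) :
  (forall i j, f x i j @[x --> F] --> M i j) ->
  \det (f x) @[x --> F] --> \det M.
Proof.
move=> fM; rewrite /determinant; apply: cvg_bigsum => s.
by apply: cvgM; [exact: cvg_cst | apply: cvg_bigprod => i; exact: fM].
Qed.

(** [invmx] is defined by cases on invertibility; the adjugate formula agrees with it on invertible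
    matrices, and its entries are quotients of polynomials in the entries of the matrix. *)
Lemma cvg_adj (U : Type) (F : set_system U) (FF : Filter F) n
    (f : U -> 'M[R]_n) (M : 'M[R]_n) :
  (forall i j, f x i j @[x --> F] --> M i j) -> M \in unitmx ->
  (\det (f x))^-1 *: \adj (f x) @[x --> F] --> invmx M.
Proof.
move=> fM uM; rewrite /invmx uM; apply: cvg_mx_entries => i j.
rewrite mxE; under eq_fun do rewrite mxE.
apply: cvgM; first by apply: cvgV; [rewrite -unitfE -unitmxE | exact: cvg_det].
rewrite mxE; under eq_fun do rewrite mxE.
apply: cvgM; first exact: cvg_cst.
apply: cvg_det => k l; rewrite !mxE; under eq_fun do rewrite !mxE.
exact: fM.
Qed.

Lemma connected_invmx n (A : set 'M[R]_n) :
  A `<=` [set M | M \in unitmx] -> connected A -> connected (invmx @` A).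
Proof.
move=> uA cA.
have -> : invmx @` A = (fun M => (\det M)^-1 *: \adj M) @` A.
  by apply: eq_imagel => M /uA uM; rewrite /invmx uM.
apply: connected_continuous_connected => //.
apply: continuous_in_subspaceT => M; rewrite inE => /uA uM.
rewrite /continuous_at; have -> : (\det M)^-1 *: \adj M = invmx M.
  by rewrite /invmx uM.
apply: (cvg_adj (nbhs_filter M) _ uM) => i j; exact: coord_continuous.
Qed.

Lemma connected_segment_mx n (A B : 'M[R]_n) :
  connected ((fun t : R => (1 - t) *: A + t *: B) @` `[0, 1]).
Proof.
apply: connected_continuous_connected; first exact: segment_connected.
apply: continuous_subspaceT => t; apply: cvg_mx_entries => i j.
rewrite !mxE; under eq_fun do rewrite !mxE.
apply: cvgD; apply: cvgM; try exact: cvg_cst; last exact: cvg_id.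
by apply: cvgB; [exact: cvg_cst | exact: cvg_id].
Qed.

(** [A] is the union of its connected subsets through [c], and these share the point [c]. An empty
    [A] satisfies the hypothesis vacuously. *)
Lemma connected_star (T : topologicalType) (A : set T) (c : T) :
  (forall x, A x -> exists B, [/\ connected B, B `<=` A, B x & B c]) ->
  connected A.
Proof.
move=> sA.
have -> : A = \bigcup_(B in [set B | [/\ connected B, B `<=` A & B c]]) B.
  apply/seteqP; split=> [x /sA[B [cB BA Bx Bc]]|x [B [_ BA _] /BA//]].
  by exists B.
by apply: bigcup_connected; [exists c => B [] | move=> B []].
Qed.

End MatrixContinuity.

(** * Positive definite matrices and their inverses *)

Section PositiveDefinite.
Variables (R : realType) (n : nat).
Implicit Types (S : 'M[R]_n) (x : 'I_n -> R).

Lemma quad_formE S (x : 'cV[R]_n) :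
  (x^T *m S *m x) 0 0 = \sum_i x i 0 * \sum_j S i j * x j 0.
Proof.
by rewrite -mulmxA mxE; apply: eq_bigr => i _; rewrite !mxE.
Qed.

Lemma posdef_gt0 S x i : posdef S -> x i != 0 ->
  0 < \sum_i x i * \sum_j S i j * x j.
Proof.
move=> [_ pS] xi; have := pS (\col_j x j); rewrite quad_formE.
under eq_bigr do under eq_bigr do rewrite mxE.
under eq_bigr do rewrite mxE.
by apply; apply: contra xi => /eqP/matrixP/(_ i 0); rewrite !mxE => ->.
Qed.

Lemma posdef_sym S i j : posdef S -> S i j = S j i.
Proof. by case=> sS _; rewrite -{1}sS mxE. Qed.

(** Extended by zero outside [C], the vector has quadratic form zero. The hypothesis is a product so
    that at each index either the coordinate or the row sum may be what vanishes. *)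
Lemma posdef_restrict S (C : pred 'I_n) x : posdef S ->
  (forall i, C i -> x i * \sum_(j | C j) S i j * x j = 0) ->
  forall i, C i -> x i = 0.
Proof.
move=> pS xC i Ci; apply/eqP; apply: contraT => xi.
pose y j := if C j then x j else 0.
have /(posdef_gt0 pS) : y i != 0 by rewrite /y Ci.
suff -> : \sum_i y i * \sum_j S i j * y j = 0 by rewrite ltxx.
rewrite big1 // => j _; rewrite {1}/y; case: ifP => [Cj|_]; last by rewrite mul0r.
rewrite -[RHS](xC j Cj); congr (_ * _); rewrite [RHS]big_mkcond /=.
by apply: eq_bigr => k _; rewrite /y; case: ifP; rewrite ?mulr0.
Qed.

Lemma posdef_diag_gt0 S i : posdef S -> 0 < S i i.
Proof.
move=> pS; have := @posdef_gt0 S (fun j => (j == i)%:R) i pS.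
rewrite eqxx oner_neq0 => /(_ isT).
rewrite (bigD1 i) //= [X in _ + X]big1 => [|j /negPf->]; last by rewrite mul0r.
rewrite eqxx mul1r addr0 (bigD1 i) //= eqxx mulr1 big1 ?addr0 //.
by move=> j /negPf->; rewrite mulr0.
Qed.

Lemma posdef_unitmx S : posdef S -> S \in unitmx.
Proof.
move=> [sS pS]; rewrite unitmxE unitfE; apply/det0P => -[v v0 vS].
have /pS : v^T != 0.
  by apply: contra v0 => /eqP/(congr1 trmx); rewrite trmxK trmx0 => ->.
by rewrite trmxK vS mul0mx mxE ltxx.
Qed.

Lemma posdef_invmx S : posdef S -> posdef (invmx S).
Proof.
move=> pS; have uS := posdef_unitmx pS; have [sS pS'] := pS.
have sK : (invmx S)^T = invmx S by rewrite trmx_inv sS.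
split=> // x x0; have := pS' (invmx S *m x).
rewrite trmx_mul sK !mulmxA mulmxKV //; apply.
by apply: contra x0 => /eqP/(congr1 (mulmx S)); rewrite mulKVmx // mulmx0 => ->.
Qed.

Lemma mul_invmx_entry S i l : S \in unitmx ->
  \sum_j S i j * invmx S j l = (i == l)%:R.
Proof.
by move=> uS; have /matrixP/(_ i l) := mulmxV uS; rewrite !mxE.
Qed.

Lemma invmx_solve S l x : S \in unitmx ->
  (forall i, \sum_j S i j * x j = (i == l)%:R) ->
  forall k, invmx S k l = x k.
Proof.
move=> uS Sx k; have -> : x k = (\col_j x j) k 0 by rewrite mxE.
suff -> : \col_j x j = invmx S *m delta_mx l 0 by rewrite -colE mxE.
rewrite -[LHS](mulKmx uS); congr (_ *m _); apply/colP => i.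
rewrite !mxE eqxx andbT -Sx; by apply: eq_bigr => j _; rewrite mxE.
Qed.

Lemma posdef1 : posdef (1%:M : 'M[R]_n).
Proof.
split=> [|x x0]; first by rewrite trmx1.
rewrite mulmx1 mxE; have [i xi] : exists i, x i 0 != 0.
  apply/existsP; apply: contraNT x0 => /existsPn x0; apply/eqP/colP => i.
  by rewrite mxE; apply/eqP/negPn/x0.
rewrite (bigD1 i) //= mxE ltr_pwDl //; last first.
  by apply: sumr_ge0 => j _; rewrite mxE -expr2 sqr_ge0.
by rewrite -expr2 exprn_even_gt0.
Qed.

Lemma posdef_segment S S' (t : R) : posdef S -> posdef S' -> t \in `[0, 1] ->
  posdef ((1 - t) *: S + t *: S').
Proof.
move=> [sS pS] [sS' pS']; rewrite in_itv /= => /andP[t0 t1].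
split=> [|x x0]; first by rewrite raddfD /= !linearZ /= sS sS'.
have /pS Sx := x0; have /pS' S'x := x0.
have -> : (x^T *m ((1 - t) *: S + t *: S') *m x) 0 0 =
    (1 - t) * (x^T *m S *m x) 0 0 + t * (x^T *m S' *m x) 0 0.
  by rewrite mulmxDr mulmxDl -!scalemxAr -!scalemxAl !mxE.
have [->|t_lt1] := eqVneq t 1; first by rewrite subrr mul0r add0r mul1r.
apply: ltr_pwDl; last by rewrite mulr_ge0 // ltW.
by rewrite mulr_gt0 // subr_gt0 lt_neqAle t_lt1.
Qed.

End PositiveDefinite.

(** * The graph of a matrix, and the case of unique paths *)

Lemma connect_uniqP (T : finType) (e : rel T) (k l : T) :
  connect e k l ->
  exists p, [/\ path e k p, last k p = l & uniq (k :: p)].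
Proof.
case/connectP => p ep ->; case/shortenP: ep => q eq uq _.
by exists q.
Qed.

Definition mx_graph (R : realType) (n : nat) (S : 'M[R]_n) : rel 'I_n :=
  [rel i j | (i != j) && (S i j != 0)].

Section Deformation.
Variables (R : realType) (n : nat).
Implicit Types (S : 'M[R]_n) (G H : rel 'I_n).

Lemma mx_graph_sub G H S : double_markov R G H S -> subrel (mx_graph S) H.
Proof.
move=> [_ _ zS] i j /= /andP[ij]; apply: contraNT => Hij.
by apply/eqP/zS; rewrite /non_edge ij.
Qed.

Lemma mx_graph_eq0 S i j : i != j -> ~~ mx_graph S i j -> S i j = 0.
Proof. by move=> ij; rewrite /mx_graph /= ij negbK => /eqP. Qed.

(** Rows of [S] in the component of [k] are supported on that component, which misses [l]. So the
    principal block of [S] there kills column [l] of the inverse. *)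
Lemma invmx_disconnected S k l : posdef S -> ~~ connect (mx_graph S) k l ->
  invmx S k l = 0.
Proof.
move=> pS kl; have uS := posdef_unitmx pS.
apply: (posdef_restrict (C := connect (mx_graph S) k)
  (x := fun j => invmx S j l) pS) => // i ki.
have il : i != l by apply: contraNneq kl => <-.
have := mul_invmx_entry i l uS; rewrite (negPf il).
rewrite (bigID (connect (mx_graph S) k)) /= [X in _ + X]big1 ?addr0.
  by move=> ->; rewrite mulr0.
move=> j kj; rewrite mx_graph_eq0 ?mul0r //; first by apply: contraNneq kj => <-.
by apply: contra kj => ij; rewrite (connect_trans ki) ?connect1.
Qed.

(** Along the segment the off-diagonal entries are only scaled by [1 - t], so the graph of the
    matrix gains no edge. *)
Lemma connected_to_1 G H S : double_markov R G H S ->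
  (forall k l, non_edge G k l -> ~~ connect (mx_graph S) k l) ->
  exists B, [/\ connected B, B `<=` double_markov R G H, B S & B 1%:M].
Proof.
move=> [pS zK zS] disc.
exists ((fun t : R => (1 - t) *: S + t *: 1%:M) @` `[0, 1]); split.
- exact: connected_segment_mx.
- move=> _ [t t01 <-]; set St := _ + _.
  have pSt : posdef St by apply: posdef_segment => //; exact: posdef1.
  have Stij i j : i != j -> St i j = (1 - t) * S i j.
    by move=> /negPf ij; rewrite !mxE ij mulr0 addr0.
  split=> // k l.
    move=> /disc kl; apply: invmx_disconnected => //; apply: contra kl.
    apply: connect_sub => i j /= /andP[ij]; rewrite Stij // mulf_eq0 negb_or.
    by move=> /andP[_ Sij]; apply: connect1; rewrite /mx_graph /= ij.
  by move=> kl; have /andP[k_l _] := kl; rewrite Stij // zS // mulr0.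
- by exists 0; rewrite /= ?in_itv /= ?lexx ?ler01 // subr0 scale1r scale0r addr0.
- by exists 1; rewrite /= ?in_itv /= ?lexx ?ler01 // subrr scale1r scale0r add0r.
Qed.

(* Without its edge [a]--[b], which is a bridge, the component [C] of [a] meets
   the rest of the graph of [S] only in that bridge.  As [invmx S a l = 0], the
   quadratic form of [S] vanishes on column [l] of the inverse cut down to [C]. *)
Lemma bridge_step S k l p1 a b p2 :
  posdef S -> invmx S a l = 0 -> a = last k p1 ->
  path (mx_graph S) k (rcons p1 b ++ p2) ->
  last b p2 = l -> uniq (k :: rcons p1 b ++ p2) ->
  (forall q, path (mx_graph S) k q -> last k q = l -> uniq (k :: q) ->
     q = rcons p1 b ++ p2) ->
  invmx S b l = 0.
Proof.
set e := mx_graph S => pS Kal a_def ep lastp up uniqp.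
have uS := posdef_unitmx pS.
have a_b : a != b.
  rewrite a_def; apply: contraTneq up => <-; rewrite -cat_cons -rcons_cons.
  by rewrite cat_uniq rcons_uniq mem_last.
pose e' : rel 'I_n :=
  [rel i j | e i j && ~~ ((i == a) && (j == b) || (i == b) && (j == a))].
(* Preceded by [p1], such a connection would give a simple path from [k] to [l] avoiding the edge
   [a]--[b], which the unique path uses. *)
have la : ~~ connect e' a l.
  have ka : connect e' k a.
    apply/connectP; exists p1 => //.
    apply: (@sub_in_path _ [pred v | v != b] e).
    - move=> i j /negPf /= ib /negPf jb /= eij.
      by apply/andP; split; [exact: eij | rewrite ib jb andbF].
    - apply/allP => v vp /=; apply: contraTneq up => <-.
      by rewrite -cat_cons -rcons_cons cat_uniq rcons_uniq vp.
    - by move: ep; rewrite cat_rcons cat_path => /andP[].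
  apply/negP => /(connect_trans ka)/connect_uniqP[q [pq lq uq]].
  have eq : path e k q by apply: sub_path pq => i j /= /andP[].
  move: (pq); rewrite (uniqp q) // cat_rcons cat_path /= -a_def.
  by rewrite /e' /= !eqxx /= !andbF.
have sumC i : connect e' a i ->
    invmx S i l * \sum_(j | connect e' a j) S i j * invmx S j l = 0.
  move=> ai; have [->|i_a] := eqVneq i a; first by rewrite Kal mul0r.
  have il : i != l by apply: contraNneq la => <-.
  have := mul_invmx_entry i l uS; rewrite (negPf il).
  rewrite (bigID (connect e' a)) /= [X in _ + X]big1 ?addr0.
    by move=> ->; rewrite mulr0.
  move=> j aj; rewrite mx_graph_eq0 ?mul0r //; first by apply: contraNneq aj => <-.
  have ja : j != a by apply: contraNneq aj => ->; exact: connect0.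
  apply: contraNN aj => ij; apply: connect_trans ai (connect1 _).
  apply/andP; split; first exact: ij.
  by rewrite (negPf i_a) (negPf ja) andbF.
have C0 := posdef_restrict pS sumC.
(* Column [l] of the inverse now vanishes on [C]. If [b] lies outside [C], row [a] of [S *m invmx S]
   at [l] reduces to [S a b * invmx S b l], which must be zero while [S a b] is not. *)
have := mul_invmx_entry a l uS.
rewrite (bigID (connect e' a)) /= big1 ?add0r; last first.
  by move=> j aj; rewrite C0 // mulr0.
have [ab|ab] := boolP (connect e' a b); first by move=> _; exact: C0.
rewrite (bigD1 b) //= big1 ?addr0.
  have /negPf-> : a != l by apply: contraNneq la => <-.
  move=> /eqP; rewrite mulf_eq0 => /orP[/eqP Sab|/eqP //].
  move: ep; rewrite cat_rcons cat_path /= -a_def => /and3P[_ + _].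
  by rewrite /e /mx_graph /= Sab eqxx andbF.
move=> j /andP[aj jb]; rewrite mx_graph_eq0 ?mul0r //.
  by apply: contraNneq aj => <-.
apply: contraNN aj => aj; apply: connect1; apply/andP; split; first exact: aj.
by rewrite (negPf jb) andbF /= negb_and a_b.
Qed.

Lemma connected_one_path_to_1 G H S : at_most_one_path G H ->
  double_markov R G H S ->
  exists B, [/\ connected B, B `<=` double_markov R G H, B S & B 1%:M].
Proof.
move=> one MS; apply: connected_to_1 => // k l kl.
have [pS zK zS] := MS; apply/negP => /connect_uniqP[p [ep lp up]].
have uniqp q : path (mx_graph S) k q -> last k q = l -> uniq (k :: q) -> q = p.
  move=> eq lq uq; suff [] : k :: q = k :: p by [].
  by apply: (one k l kl); [exists q | exists p]; split=> //;
    apply: sub_path (mx_graph_sub MS) _ _ _.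
suff : invmx S l l = 0.
  by move=> Kll; have := posdef_diag_gt0 l (posdef_invmx pS); rewrite Kll ltxx.
(* Induction on the prefix already travelled: the empty prefix is the non-edge [k l] itself, and the
   whole path ends at [l]. *)
suff K0 p1 p2 : p = p1 ++ p2 -> invmx S (last k p1) l = 0.
  by rewrite -{1}lp; apply: (K0 p [::]); rewrite cats0.
elim/last_ind: p1 p2 => [|p1 b IHp] p2 def_p /=; first exact: zK.
rewrite last_rcons.
apply: (@bridge_step S k l p1 _ b p2 pS _ erefl); rewrite -?def_p //.
- by apply: (IHp (b :: p2)); rewrite def_p cat_rcons.
- by rewrite -lp def_p last_cat last_rcons.
Qed.

End Deformation.

(** * Scaling down one vertex: the case of paths through a common vertex *)

Section IsolateVertex.
Variables (R : realType) (n : nat) (v : 'I_n).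
Implicit Types (S : 'M[R]_n) (G H : rel 'I_n).

Definition isolate S : 'M[R]_n :=
  \matrix_(i, j) if (i == v) (+) (j == v) then 0 else S i j.

(** Given as a point of the segment from [isolate S] to [S], so that positive definiteness follows
    by convexity. *)
Definition scale_vertex S (t : R) : 'M[R]_n :=
  (1 - t) *: isolate S + t *: S.

Lemma scale_vertexE S t i j :
  scale_vertex S t i j = if (i == v) (+) (j == v) then t * S i j else S i j.
Proof.
rewrite !mxE; case: ifP => _; first by rewrite mulr0 add0r.
by rewrite mulrBl mul1r subrK.
Qed.

(** With [J] the diagonal sign matrix that is -1 exactly at [v], [isolate S] is the midpoint of [S]
    and its congruent [J *m S *m J]. *)
Lemma posdef_isolate S : posdef S -> posdef (isolate S).
Proof.
move=> pS; pose J : 'M[R]_n := diag_mx (\row_j (-1) ^+ (j == v)).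
have JJ : J *m J = 1%:M.
  by apply/matrixP => i j; rewrite mul_diag_mx !mxE mulrnAr -expr2 sqrr_sign.
have JT : J^T = J by rewrite tr_diag_mx.
have pJ : posdef (J *m S *m J).
  have [sS pS'] := pS; split; first by rewrite !trmx_mul JT sS mulmxA.
  move=> x x0; have := pS' (J *m x); rewrite trmx_mul JT !mulmxA; apply.
  by apply: contra x0 => /eqP/(congr1 (mulmx J)); rewrite mulmxA JJ mul1mx mulmx0 => ->.
have half : 2^-1 \in `[0, 1 :> R].
  by rewrite in_itv /= invr_ge0 ler0n invf_le1 ?ltr0n ?ler1n.
have := posdef_segment pS pJ half; congr posdef; apply/matrixP => i j.
rewrite mul_diag_mx mul_mx_diag !mxE.
case: (i == v); case: (j == v); rewrite /= ?expr0 ?expr1; by field.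
Qed.

Lemma posdef_scale_vertex S t : posdef S -> t \in `[0, 1] ->
  posdef (scale_vertex S t).
Proof. by move=> pS; apply: posdef_segment => //; apply: posdef_isolate. Qed.

Lemma isolate_graph S i j : mx_graph (isolate S) i j ->
  [/\ mx_graph S i j, i != v & j != v].
Proof.
rewrite /mx_graph /= !mxE; case: (eqVneq i v) => [->|iv];
  case: (eqVneq j v) => [->|jv]; rewrite /= ?eqxx ?andbF //.
Qed.

Lemma isolate_disconnected S k l p : k != l ->
  path (mx_graph (isolate S)) k p -> last k p = l -> v \notin k :: p.
Proof.
case: p => [|a p] kl /=; first by move=> _ lk; rewrite lk eqxx in kl.
move=> /andP[/isolate_graph[_ kv av] ep] _.
rewrite !inE !negb_or !(eq_sym v) kv av /=.
elim: p a ep {av} => //= b p IHp a /andP[/isolate_graph[_ _ bv] /IHp].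
by rewrite inE negb_or eq_sym bv.
Qed.

(* Column [v] of the inverse, with its entries off [v] multiplied by [t], is
   still a multiple of column [v] of the inverse of the scaled matrix. *)
Lemma scale_vertex_column S t : posdef S -> t \in `[0, 1] ->
  exists2 d : R, d != 0 &
  forall i, \sum_j scale_vertex S t i j *
    (if j == v then invmx S v v else t * invmx S j v) = (i == v)%:R * d.
Proof.
move=> pS t01; have uS := posdef_unitmx pS.
pose x j := if j == v then invmx S v v else t * invmx S j v.
pose d := \sum_j scale_vertex S t v j * x j.
have xE i : \sum_j scale_vertex S t i j * x j = (i == v)%:R * d.
  have [->|iv] := eqVneq i v; first by rewrite mul1r.
  transitivity (t * \sum_j S i j * invmx S j v).
    2: by rewrite mul_invmx_entry // (negPf iv) mulr0 mul0r.
  rewrite mulr_sumr; apply: eq_bigr => j _.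
  rewrite scale_vertexE (negPf iv) /x; case: (eqVneq j v) => [->|jv] /=.
    by rewrite mulrA.
  by rewrite mulrCA.
(* The quadratic form of the scaled matrix at [x] is [x v * d], and [x v] is nonzero; so [d = 0]
   would contradict positivity. *)
exists d => //; have := @posdef_gt0 _ _ _ x v (posdef_scale_vertex pS t01).
rewrite {1}/x eqxx (gt_eqF (posdef_diag_gt0 v (posdef_invmx pS))) => /(_ isT).
by apply: contraTneq => d0; rewrite big1 ?ltxx // => i _; rewrite xE d0 !mulr0.
Qed.

Lemma isolated_disconnected S l : l != v -> ~~ connect (mx_graph (isolate S)) v l.
Proof.
move=> lv; apply/negP => /connect_uniqP[p [ep lp _]].
have vl : v != l by rewrite eq_sym.
by have := isolate_disconnected vl ep lp; rewrite mem_head.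
Qed.

(** The scaled matrix sends column [l] of the inverse of [isolate S] to the unit vector of [l], up
    to an error in row [v]. The vector of [scale_vertex_column], whose image lives in row [v],
    cancels this error. *)
Lemma invmx_scale_vertex S t l : posdef S -> t \in `[0, 1] -> l != v ->
  exists2 d : R, d != 0 & forall k, invmx (scale_vertex S t) k l =
    invmx (isolate S) k l -
    t * (\sum_j S v j * invmx (isolate S) j l) / d *
      (if k == v then invmx S v v else t * invmx S k v).
Proof.
move=> pS t01 lv; have [d d0 dE] := scale_vertex_column pS t01.
have pS0 := posdef_isolate pS.
exists d => //; set b := \sum_j _.
apply: invmx_solve; first exact/posdef_unitmx/posdef_scale_vertex.
have y0 : invmx (isolate S) v l = 0.
  by apply: invmx_disconnected => //; exact: isolated_disconnected.
move=> i; under eq_bigr do rewrite mulrBr mulrCA.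
rewrite sumrB -mulr_sumr dE [_ * d]mulrC mulrA divfK //.
have [->|iv] := eqVneq i v; last first.
  rewrite mulr0 subr0 -(mul_invmx_entry i l (posdef_unitmx pS0)).
  apply: eq_bigr => j _; have [->|jv] := eqVneq j v; first by rewrite y0 !mulr0.
  by rewrite scale_vertexE mxE (negPf iv) (negPf jv).
rewrite mulr1 eq_sym (negPf lv) /b mulr_sumr; apply/eqP; rewrite subr_eq0.
apply/eqP/eq_bigr => j _; have [->|jv] := eqVneq j v; first by rewrite y0 !mulr0.
by rewrite scale_vertexE eqxx (negPf jv) mulrA.
Qed.

Lemma double_markov_scale_vertex G H S t : paths_through G H v ->
  double_markov R G H S -> t \in `[0, 1] ->
  double_markov R G H (scale_vertex S t).
Proof.
move=> thru MS t01; have [pS zK zS] := MS; split.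
- exact: posdef_scale_vertex.
- move=> k l kl; have /andP[k_l _] := kl.
  have [lv|lv] := eqVneq l v.
    have [d d0 dE] := scale_vertex_column pS t01.
    rewrite lv (@invmx_solve _ _ _ _
      (fun j => d^-1 * (if j == v then invmx S v v else t * invmx S j v))).
    + by rewrite -lv (negPf k_l) zK // !mulr0.
    + exact/posdef_unitmx/posdef_scale_vertex.
    + move=> i; under eq_bigr do rewrite mulrCA.
      by rewrite -mulr_sumr dE mulrCA mulVf // mulr1.
  have y0 : invmx (isolate S) k l = 0.
    apply: invmx_disconnected; first exact: posdef_isolate.
    apply/negP => /connect_uniqP[p [ep lp up]].
    have := isolate_disconnected k_l ep lp; apply/negP; rewrite negbK.
    apply: (thru k l kl); exists p; split=> //.
    by apply: sub_path ep => i j /isolate_graph[ij _ _]; exact: mx_graph_sub MS _ _ ij.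
  have [d d0 ->] := invmx_scale_vertex pS t01 lv.
  (* At [t = 1] the formula describes the inverse of [S] itself, which is zero at [k l]. So the sum
     over row [v] or the column factor is zero, and either makes the correction vanish for every
     [t]. *)
  have i01 : 1 \in `[0, 1 :> R] by rewrite in_itv /= ler01 lexx.
  have [d1 d10 /(_ k)] := invmx_scale_vertex pS i01 lv.
  rewrite /scale_vertex subrr scale0r add0r scale1r zK // y0 !sub0r.
  set b := \sum_j _ => /eqP; rewrite !mul1r eq_sym oppr_eq0 !mulf_eq0.
  rewrite invr_eq0 (negPf d10) orbF.
  move=> /orP[] /eqP b0; first by rewrite b0 mulr0 !mul0r oppr0.
  case: ifP b0 => _ ->; rewrite ?mul1r ?mulr0 ?oppr0 //.
- by move=> k l /zS kl; rewrite scale_vertexE kl mulr0 if_same.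
Qed.

Lemma connected_paths_through_to_1 G H S : paths_through G H v ->
  double_markov R G H S ->
  exists B, [/\ connected B, B `<=` double_markov R G H, B S & B 1%:M].
Proof.
move=> thru MS; have [pS _ _] := MS.
have i0 : 0 \in `[0, 1 :> R] by rewrite in_itv /= ler01 lexx.
have S0E : isolate S = scale_vertex S 0.
  by rewrite /scale_vertex subr0 scale1r scale0r addr0.
have MS0 : double_markov R G H (isolate S).
  by rewrite S0E; exact: double_markov_scale_vertex.
have [B [cB BM BS0 B1]] : exists B,
    [/\ connected B, B `<=` double_markov R G H, B (isolate S) & B 1%:M].
  apply: connected_to_1 => // k l kl; have /andP[k_l _] := kl.
  apply/negP => /connect_uniqP[p [ep lp up]].
  have := isolate_disconnected k_l ep lp; apply/negP; rewrite negbK.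
  apply: (thru k l kl); exists p; split=> //.
  by apply: sub_path ep => i j; exact: mx_graph_sub MS0 i j.
(* Two legs, from [S] to [isolate S] and on to the identity, meeting at [isolate S]. *)
exists (scale_vertex S @` `[0, 1] `|` B); split; try by right.
- apply: connectedU => //; last exact: connected_segment_mx.
  by exists (isolate S); split=> //; exists 0.
- move=> _ [[t t01 <-]|/BM //]; exact: double_markov_scale_vertex.
- left; exists 1; rewrite /= ?in_itv /= ?ler01 ?lexx //.
  by rewrite /scale_vertex subrr scale0r add0r scale1r.
Qed.

End IsolateVertex.

(** * Decoupling along the components of the common graph *)

Section Decoupling.
Variable R : realType.

(** Cholesky factorization, by induction on the Schur complement of the top left entry. *)
Lemma posdef_factor n (S : 'M[R]_n) : posdef S ->
  exists C : 'M[R]_n, S = C *m C^T.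
Proof.
elim: n S => [|n IHn] S pS; first by exists 0; apply/matrixP => -[].
pose a := S 0 0; have a0 : 0 < a by exact: posdef_diag_gt0.
have [sS pS'] := pS.
pose S1 : 'M[R]_(1 + n) := S.
pose b := dlsubmx S1; pose D := drsubmx S1.
have ulS : ulsubmx S1 = a%:M.
  by rewrite [LHS]mx11_scalar !mxE lshift0.
have urS : ursubmx S1 = b^T by rewrite /b trmx_dlsub /S1 sS.
have defS : S1 = block_mx a%:M b^T b D by rewrite -ulS -urS submxK.
have sD : D^T = D by rewrite trmx_drsub /S1 sS.
have [|C CE] := IHn (D - a^-1 *: (b *m b^T)).
  split=> [|y y0].
    by rewrite raddfB /= sD linearZ /= trmx_mul trmxK.
  (* This first coordinate annihilates the first entry of [S1 *m x], so that the form of [S] at [x]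
     is that of the Schur complement at [y]. *)
  pose x := col_mx (- a^-1 *: (b^T *m y)) y.
  have x0 : x != 0 by rewrite col_mx_eq0 negb_and y0 orbT.
  have pS1 : forall z : 'cV_(1 + n), z != 0 -> 0 < (z^T *m S1 *m z) 0 0 := pS'.
  have := pS1 x x0; rewrite -mulmxA defS mul_block_col.
  rewrite mul_scalar_mx scalerA mulrN mulfV ?gt_eqF // scaleN1r addNr.
  rewrite tr_col_mx mul_row_col mulmx0 add0r -mulmxA.
  suff -> : b *m (- a^-1 *: (b^T *m y)) + D *m y =
    (D - a^-1 *: (b *m b^T)) *m y by [].
  by rewrite mulmxBl -scalemxAl -scalemxAr mulmxA scaleNr addrC.
pose r := Num.sqrt a; have r0 : r != 0 by rewrite gt_eqF // sqrtr_gt0.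
have rr : r * r = a by rewrite -expr2 sqr_sqrtr // ltW.
change (exists C : 'M[R]_(1 + n), S1 = C *m C^T).
exists (block_mx r%:M 0 (r^-1 *: b) C).
rewrite defS tr_block_mx mulmx_block !trmx0 tr_scalar_mx !mulmx0 !mul0mx.
rewrite !addr0 -CE -scalar_mxM rr mul_scalar_mx mul_mx_scalar linearZ /=.
rewrite !scalerA mulfV // !scale1r -scalemxAl -scalemxAr scalerA.
by rewrite -invfM rr addrC subrK.
Qed.

Lemma mxtrace_gram_eq0 n (A : 'M[R]_n) : \tr (A *m A^T) = 0 -> A = 0.
Proof.
move=> trA; apply/matrixP => i j; rewrite mxE.
have sq0 k l : true -> 0 <= A k l ^+ 2 by move=> _; exact: sqr_ge0.
have row0 k : true -> 0 <= \sum_l A k l ^+ 2 by move=> _; apply: sumr_ge0; exact: sq0.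
have : \sum_k \sum_l A k l ^+ 2 = 0.
  rewrite -[RHS]trA; apply: eq_bigr => k _; rewrite mxE.
  by apply: eq_bigr => l _; rewrite mxE.
move=> /(psumr_eq0P row0)/(_ i isT)/(psumr_eq0P (sq0 i))/(_ j isT)/eqP.
by rewrite sqrf_eq0 => /eqP.
Qed.

(** Writing [K = C *m C^T], the trace is the squared Frobenius norm of [C^T *m X *m C], and [C] is
    invertible. *)
Lemma mxtrace_posdef_eq0 n (K X : 'M[R]_n) : posdef K ->
  \tr (X *m K *m X^T *m K) = 0 -> X = 0.
Proof.
move=> pK; have uK := posdef_unitmx pK; have [C KE] := posdef_factor pK.
have uC : C \in unitmx by move: uK; rewrite KE unitmx_mul => /andP[].
have uCT : C^T \in unitmx by rewrite unitmx_tr.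
rewrite {1}KE {1}KE !mulmxA mxtrace_mulC !mulmxA => trX.
have /(congr1 (mulmx (invmx C^T))) : C^T *m X *m C = 0.
  by apply: mxtrace_gram_eq0; rewrite !trmx_mul trmxK !mulmxA.
rewrite mulmx0 -mulmxA mulKmx // => /(congr1 (mulmx^~ (invmx C))).
by rewrite mulmxK // mul0mx.
Qed.

Variable n : nat.
Implicit Types (S : 'M[R]_n) (G H : rel 'I_n).

(* With [P] the projection onto [B] and [X = P S - S P], the trace of
   [X K X^T K] is [2 \tr P - 2 \tr (P S P K)], and the hypothesis makes it
   vanish. *)
Lemma posdef_decouple S (B : pred 'I_n) : posdef S ->
  (forall i j, B i -> ~~ B j -> S i j * invmx S j i = 0) ->
  forall i j, B i -> ~~ B j -> S i j = 0.
Proof.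
move=> pS SK0; set K := invmx S; have uS := posdef_unitmx pS.
have pK := posdef_invmx pS; have [sS _] := pS.
pose P : 'M[R]_n := diag_mx (\row_j (B j)%:R).
have PP : P *m P = P.
  apply/matrixP => i j; rewrite mul_diag_mx !mxE mulrnAr.
  by case: (B i); rewrite ?mul1r ?mul0r.
have SK : S *m K = 1%:M by exact: mulmxV.
have KS : K *m S = 1%:M by exact: mulVmx.
(* For [i] in [B] the terms with [j] outside [B] vanish by hypothesis, so the truncated sum is a
   full diagonal entry of [S *m K]. *)
have trPSPK : \tr (P *m S *m P *m K) = \tr P.
  apply: eq_bigr => i _; rewrite !mxE eqxx mulr1n.
  transitivity ((B i)%:R * \sum_j S i j * K j i).
    2: by rewrite mul_invmx_entry // eqxx mulr1.
  rewrite mulr_sumr; apply: eq_bigr => j _.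
  rewrite mul_mx_diag mul_diag_mx !mxE.
  case: (boolP (B i)) => Bi; last by rewrite !mul0r.
  case: (boolP (B j)) => Bj; first by rewrite !mul1r mulr1.
  by rewrite SK0 // mulr0 mul0r mulr0.
pose X := P *m S - S *m P.
suff X0 : X = 0.
  move=> i j Bi Bj; have /matrixP/(_ i j) := X0.
  by rewrite /X mul_diag_mx mul_mx_diag !mxE Bi (negPf Bj) mul1r mulr0 subr0.
apply: (mxtrace_posdef_eq0 pK).
have -> : X^T = - X.
  by rewrite /X raddfB /= !trmx_mul tr_diag_mx sS opprB.
have XK : X *m K = P - S *m P *m K.
  by rewrite /X mulmxBl -[P *m S *m K]mulmxA SK mulmx1.
rewrite mulmxN mulNmx -[X *m K *m X *m K]mulmxA XK mulmxBl !mulmxBr PP.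
have -> : S *m P *m K *m (S *m P *m K) = S *m P *m K.
  by rewrite !mulmxA -[_ *m K *m S]mulmxA KS mulmx1 -[_ *m P *m P]mulmxA PP.
have tr1 : \tr (S *m P *m K) = \tr P.
  by rewrite mxtrace_mulC mulmxA KS mul1mx.
have tr2 : \tr (S *m P *m K *m P) = \tr P.
  by rewrite mxtrace_mulC !mulmxA.
have trB (U V : 'M[R]_n) : \tr (U - V) = \tr U - \tr V by rewrite raddfB.
have trN (U : 'M[R]_n) : \tr (- U) = - \tr U by rewrite raddfN.
by rewrite trN !trB !mulmxA trPSPK tr1 tr2 !subrr oppr0.
Qed.

Definition common (G H : rel 'I_n) : rel 'I_n := [rel i j | G i j && H i j].

Definition restrict_rel (F G : rel 'I_n) : rel 'I_n :=
  [rel i j | G i j && connect F i j].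

(** A pair leaving the component of [i] is missing from [G] or from [H], so the entry of the inverse
    or that of [S] is zero, as [posdef_decouple] requires. *)
Lemma double_markov_decouple G H S i j : double_markov R G H S ->
  ~~ connect (common G H) i j -> S i j = 0.
Proof.
move=> [pS zK zS] ij; have pK := posdef_invmx pS.
apply: (posdef_decouple (B := connect (common G H) i) pS) => // k l ik il.
have kl : k != l by apply: contraNneq il => <-.
have : ~~ common G H k l.
  by apply: contra il => kl'; apply: connect_trans ik (connect1 _).
rewrite /common /= negb_and => /orP[Gkl|Hkl].
  by rewrite (posdef_sym _ _ pK) zK ?mulr0 // /non_edge kl.
by rewrite zS ?mul0r // /non_edge kl.
Qed.

Lemma double_markov_invmx G H S : double_markov R G H S ->
  double_markov R H G (invmx S).
Proof.
by move=> [pS zK zS]; split; rewrite ?invmxK //; exact: posdef_invmx.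
Qed.

Lemma double_markov_swap G H : double_markov R G H = invmx @` double_markov R H G.
Proof.
apply/seteqP; split=> [S MS|_ [S MS <-]]; last exact: double_markov_invmx.
by exists (invmx S); [exact: double_markov_invmx | exact: invmxK].
Qed.

Lemma connected_double_markov_swap G H :
  connected (double_markov R H G) -> connected (double_markov R G H).
Proof.
move=> cM; rewrite double_markov_swap; apply: connected_invmx => //.
by move=> S [pS _ _]; exact: posdef_unitmx.
Qed.

Lemma commonC G H : common G H = common H G.
Proof. by apply/funext => i; apply/funext => j; rewrite /common /= andbC. Qed.

(** An edge dropped by the restriction joins two components of the intersection. The zeros this
    imposes hold already by decoupling, applied to [S] for [H] and to its inverse for [G]. *)
Lemma double_markov_within G H :
  double_markov R G H =
  double_markov R (restrict_rel (common G H) G) (restrict_rel (common G H) H).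
Proof.
apply/seteqP; split=> S MS; have [pS zK zS] := MS; split=> // i j.
- rewrite /non_edge negb_and => /andP[ij /orP[Gij|Fij]].
    by apply: zK; rewrite /non_edge ij.
  by apply: (double_markov_decouple (double_markov_invmx MS)); rewrite commonC.
- rewrite /non_edge negb_and => /andP[ij /orP[Hij|Fij]].
    by apply: zS; rewrite /non_edge ij.
  exact: double_markov_decouple MS Fij.
- by move=> /andP[ij Gij]; apply: zK; rewrite /non_edge ij negb_and Gij.
- by move=> /andP[ij Hij]; apply: zS; rewrite /non_edge ij negb_and Hij.
Qed.

End Decoupling.

(** * Combinatorics of graphs with at most three edges *)

Section FewCommonEdges.
Variables (T : finType) (F : rel T).
Hypotheses (symF : symmetric F) (irrF : irreflexive F).

Lemma set2_eq (a b c d : T) : [set a; b]%SET = [set c; d]%SET ->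
  a = c /\ b = d \/ a = d /\ b = c.
Proof.
move=> E; have : a \in [set c; d]%SET by rewrite -E !inE eqxx.
have : b \in [set c; d]%SET by rewrite -E !inE eqxx orbT.
have : c \in [set a; b]%SET by rewrite E !inE eqxx.
have : d \in [set a; b]%SET by rewrite E !inE eqxx orbT.
rewrite !inE => /orP[]/eqP dE /orP[]/eqP cE /orP[]/eqP bE /orP[]/eqP aE;
  by first [left; split; congruence | right; split; congruence].
Qed.

Lemma edge_mem (i j : T) : F i j -> [set i; j]%SET \in edges F.
Proof. by move=> Fij; apply/imsetP; exists (i, j); rewrite ?inE. Qed.

Lemma uniq_edges (s : seq {set T}) : uniq s -> {subset s <= edges F} ->
  (size s <= #|edges F|)%N.
Proof.
by move=> /card_uniqP <- sF; apply: subset_leq_card; apply/fintype.subsetP.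
Qed.

Lemma neighbor_of_connect (k l : T) : k != l -> connect F k l ->
  exists x, F k x.
Proof.
move=> kl /connectP[[|x p] /=]; first by move=> _ lk; rewrite lk eqxx in kl.
by move=> /andP[Fkx _] _; exists x.
Qed.

Hypothesis few : (#|edges F| <= 3)%N.

(** Any other edge would be a fourth element of [edges F]. *)
Lemma edge_of_three (a1 b1 a2 b2 a3 b3 : T) :
  uniq [:: [set a1; b1]; [set a2; b2]; [set a3; b3]]%SET ->
  F a1 b1 -> F a2 b2 -> F a3 b3 -> forall i j, F i j ->
  (i, j) \in [:: (a1, b1); (b1, a1); (a2, b2); (b2, a2); (a3, b3); (b3, a3)].
Proof.
move=> us F1 F2 F3 i j Fij.
set s := [:: _; _; _]%SET in us.
have : [set i; j]%SET \in s.
  apply: contraT => ijs; have : uniq ([set i; j]%SET :: s) by rewrite cons_uniq ijs.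
  move=> /uniq_edges/(_ _)/leq_trans/(_ few) /= abs; suff : false by []; apply: abs.
  by move=> e; rewrite !inE => /or4P[] /eqP->; exact: edge_mem.
rewrite !inE => /or3P[] /eqP/set2_eq[] [-> ->]; by rewrite !xpair_eqE !eqxx ?orbT.
Qed.

Lemma path4_edges (a b c d : T) : uniq [:: a; b; c; d] ->
  F a b -> F b c -> F c d -> forall i j, F i j ->
  (i, j) \in [:: (a, b); (b, a); (b, c); (c, b); (c, d); (d, c)].
Proof.
move=> u Fab Fbc Fcd; apply: edge_of_three => //.
move: u; rewrite /= !inE !negb_or !andbT.
move=> /and3P[/and3P[/eqP ab /eqP ac /eqP ad] /andP[/eqP bc /eqP bd] /eqP cd].
by apply/andP; split; [apply/andP; split|]; apply/eqP => /set2_eq; intuition congruence.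
Qed.

Lemma star_edges (m a b c : T) : uniq [:: m; a; b; c] ->
  F m a -> F m b -> F m c -> forall i j, F i j ->
  (i, j) \in [:: (m, a); (a, m); (m, b); (b, m); (m, c); (c, m)].
Proof.
move=> u Fma Fmb Fmc; apply: edge_of_three => //.
move: u; rewrite /= !inE !negb_or !andbT.
move=> /and3P[/and3P[/eqP ma /eqP mb /eqP mc] /andP[/eqP ab /eqP ac] /eqP bc].
by apply/andP; split; [apply/andP; split|]; apply/eqP => /set2_eq; intuition congruence.
Qed.

Lemma connect_in_edges (s : seq T) (k l : T) : k != l -> connect F k l ->
  (forall i j, F i j -> i \in s) -> (k \in s) && (l \in s).
Proof.
move=> kl ckl Fs; have [x /Fs ->] := neighbor_of_connect kl ckl.
rewrite eq_sym in kl; rewrite (sym_connect_sym symF) in ckl.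
by have [y /Fs] := neighbor_of_connect kl ckl.
Qed.

(** A simple path with three or more edges would start with a path on four vertices. *)
Lemma connect_distance2 (k l : T) : k != l -> connect F k l -> ~~ F k l ->
  (forall a b c d, uniq [:: a; b; c; d] -> F a b -> F b c -> F c d -> False) ->
  exists m, F k m /\ F m l.
Proof.
move=> kl /connect_uniqP[p [ep lp up]] nF noP4.
case: p ep lp up => [|x [|y [|z p]]] /=.
- by move=> _ lk; rewrite lk eqxx in kl.
- by rewrite andbT => Fkx lx; rewrite -lx Fkx in nF.
- by move=> /and3P[Fkx Fxy _] <- _; exists x.
- move=> /and4P[Fkx Fxy Fyz _] _ u; case: (noP4 k x y z) => //.
  move: u; rewrite /= !inE !negb_or => /and4P[/and4P[-> -> -> _] /and3P[-> -> _]].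
  by move=> /andP[-> _] _.
Qed.

Lemma path4_of_neighbors (a b c d : T) : F a b -> F b c -> F c d ->
  a != c -> a != d -> b != d -> uniq [:: a; b; c; d].
Proof.
move=> ab bc cd ac ad bd; rewrite /= !inE !negb_or ac ad bd !andbT /=.
by apply/and3P; split; apply/negP => /eqP E; move: ab bc cd; rewrite E irrF.
Qed.

Lemma star_of_neighbors (m a b c : T) : F m a -> F m b -> F m c ->
  a != b -> a != c -> b != c -> uniq [:: m; a; b; c].
Proof.
move=> ma mb mc ab ac bc; rewrite /= !inE !negb_or ab ac bc !andbT /=.
by apply/and3P; split; apply/negP => /eqP E; move: ma mb mc; rewrite E irrF.
Qed.

(** Otherwise the four edges of the two paths of length two are distinct, one more than allowed:
    each coincidence between them forces a path on four vertices, a star with three leaves or a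
    contradiction with the hypotheses. *)
Lemma distance2_meet (k l m k' l' m' : T) :
  (forall a b c d, uniq [:: a; b; c; d] -> F a b -> F b c -> F c d -> False) ->
  (forall a b c d, uniq [:: a; b; c; d] -> F a b -> F a c -> F a d -> False) ->
  k != l -> ~~ F k l -> F k m -> F m l ->
  k' != l' -> ~~ F k' l' -> F k' m' -> F m' l' ->
  k = k' \/ k = l'.
Proof.
move=> noP4 noStar kl nkl km ml kl' nkl' km' ml'.
have [->|kk'] := eqVneq k k'; first by left.
have [->|kl''] := eqVneq k l'; first by right.
exfalso.
have [mk lm mk' lm'] : [/\ F m k, F l m, F m' k' & F l' m'].
  by rewrite !(symF m) !(symF m') (symF l) (symF l') km ml km' ml'.
have neq2 (a b c d : T) : (a = c -> b = d -> False) -> (a = d -> b = c -> False) ->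
    [set a; b]%SET != [set c; d]%SET.
  by move=> h1 h2; apply/eqP => /set2_eq[] [] ? ?; [exact: h1 | exact: h2].
have P4 (a b c d : T) : F a b -> F b c -> F c d -> a != c -> a != d -> b != d -> False.
  by move=> ab bc cd ac ad bd;
    exact: noP4 (path4_of_neighbors ab bc cd ac ad bd) ab bc cd.
have St (x a b c : T) : F x a -> F x b -> F x c -> a != b -> a != c -> b != c -> False.
  by move=> xa xb xc ab ac bc;
    exact: noStar (star_of_neighbors xa xb xc ab ac bc) xa xb xc.
have e12 : [set k; m]%SET != [set m; l]%SET.
  by apply: neq2 => [E E'|E _]; [rewrite E E' eqxx in kl | rewrite E eqxx in kl].
have e34 : [set k'; m']%SET != [set m'; l']%SET.
  by apply: neq2 => [E E'|E _]; [rewrite E E' eqxx in kl' | rewrite E eqxx in kl'].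
have e13 : [set k; m]%SET != [set k'; m']%SET.
  apply: neq2 => [E|E E']; first by rewrite E eqxx in kk'.
  subst m m'; apply: (P4 l k' k l') => //; first by rewrite eq_sym.
  by apply: contraNneq nkl => ->.
have e14 : [set k; m]%SET != [set m'; l']%SET.
  apply: neq2 => [E E'|E]; last by rewrite E eqxx in kl''.
  subst m m'; apply: (P4 l l' k k') => //; rewrite 1?eq_sym //.
  by apply: contraNneq nkl => <-.
have e23 : [set m; l]%SET != [set k'; m']%SET.
  apply: neq2 => [E E'|E E']; first by subst m m'; exact: (P4 k k' l l').
  by subst m l; exact: (St m' k k' l').
have e24 : [set m; l]%SET != [set m'; l']%SET.
  apply: neq2 => [E E'|E E']; first subst m l.
    by apply: (St m' k l' k') => //; rewrite eq_sym.
  by subst m m'; apply: (P4 k l' l k') => //; rewrite eq_sym.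
have u : uniq [:: [set k; m]; [set m; l]; [set k'; m']; [set m'; l']]%SET.
  by rewrite /= !inE !negb_or e12 e13 e14 e23 e24 e34.
have : (4 <= 3)%N; last by [].
apply: leq_trans (uniq_edges u _) few.
by move=> e; rewrite !inE => /or4P[] /eqP->; exact: edge_mem.
Qed.

Variables (G H : rel T).
Hypotheses (GH : forall i j, G i j && H i j = F i j).
Hypotheses (GF : subrel G (connect F)) (HF : subrel H (connect F)).

(** Here [v] is an endpoint of every relevant non-edge, and paths contain their endpoints. *)
Lemma paths_through_cover (v : T) :
  (forall k l, k != l -> connect F k l -> ~~ G k l -> k = v \/ l = v) ->
  paths_through G H v.
Proof.
move=> cov k l /andP[kl Gkl] _ [p [-> Hp lp _]].
have ckl : connect F k l.
  by apply: (connect_sub HF); apply/connectP; exists p.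
case: (cov k l kl ckl Gkl) => [->|<-]; first exact: mem_head.
by rewrite -lp mem_last.
Qed.

(** A simple path avoiding [v] can only use the edge [a]--[b], hence has a single edge; its ends are
    then adjacent in [F] and so in [G]. *)
Lemma paths_through_hub (v a b : T) : subrel H F -> F a b ->
  (forall i j, F i j -> [|| i == v, j == v, (i == a) && (j == b) |
     (i == b) && (j == a)]) ->
  paths_through G H v.
Proof.
move=> sHF Fab hub k l /andP[kl Gkl] _ [p [-> Hp lp up]].
apply: contraNT Gkl; rewrite inE negb_or => /andP[].
have FG : F k l -> G k l by rewrite -GH => /andP[].
case: p Hp lp up => [|x p] /=; first by move=> _ lk; rewrite lk eqxx in kl.
move=> /andP[/sHF Fkx]; case: p => [|y p] /=.
  by move=> _ <-; rewrite -GH in Fkx; case/andP: Fkx.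
move=> /andP[/sHF Fxy _] _ u vk; rewrite !inE !negb_or => /and3P[vx vy _].
move: u; rewrite !inE !negb_or => /and3P[/and3P[kx ky _] /andP[xy _] _].
have := hub k x Fkx; have := hub x y Fxy.
rewrite !(eq_sym _ v) (negPf vk) (negPf vx) (negPf vy) /=.
move=> /orP[] /andP[/eqP xE /eqP yE] /orP[] /andP[/eqP kE /eqP xE'];
 by move: kx ky xy; rewrite ?xE ?yE ?kE ?xE' -?xE' ?eqxx.
Qed.

End FewCommonEdges.

(** * Reduction of three common edges to paths through a vertex *)

Section FewCommonEdgesCover.
Variables (T : finType) (F : rel T).
Hypotheses (symF : symmetric F) (irrF : irreflexive F).
Hypothesis few : (#|edges F| <= 3)%N.

(* The situation after restricting both graphs to the components of their
   intersection [F]. *)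
Definition splits (G H : rel T) : Prop :=
  [/\ symmetric G /\ symmetric H, irreflexive G /\ irreflexive H,
      forall i j, G i j && H i j = F i j,
      subrel G (connect F) & subrel H (connect F)].

Lemma splitsC (G H : rel T) : splits G H -> splits H G.
Proof.
by move=> [[sG sH] [iG iH] GH GF HF]; split=> // i j; rewrite andbC.
Qed.

Lemma splits_sub (G H : rel T) : splits G H -> subrel F G.
Proof. by move=> [_ _ GH _ _] i j; rewrite -GH => /andP[]. Qed.

(** The chord makes [a], [b], [c] a triangle of [G], so every non-edge of [G] inside the component
    has [d] as an endpoint. *)
Lemma path4_extra (a b c d : T) (G H : rel T) : splits G H ->
  uniq [:: a; b; c; d] -> F a b -> F b c -> F c d -> G a c ->
  paths_through G H d.
Proof.
move=> GH u Fab Fbc Fcd Gac; have [[sG _] _ _ _ HF] := GH.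
have FG := splits_sub GH.
apply: (paths_through_cover HF) => k l kl ckl.
have /andP[] : (k \in [:: a; b; c; d]) && (l \in [:: a; b; c; d]).
  apply: (connect_in_edges symF) => // i j /(path4_edges few u Fab Fbc Fcd).
  by rewrite !inE !xpair_eqE => /or4P[|||/or3P[]] /andP[/eqP-> _]; rewrite eqxx ?orbT.
have [Gab Gbc Gcd] : [/\ G a b, G b c & G c d] by split; exact: FG.
rewrite !inE => /or4P[] /eqP kE /or4P[] /eqP lE; subst k l; move: kl;
  rewrite ?eqxx ?(sG b a) ?(sG c a) ?(sG c b) ?Gab ?Gbc ?Gac //=;
  by [left | right].
Qed.

(** Without chords [G] is the path itself, and all its edges except [c]--[d] contain [b]. *)
Lemma path4_sub (a b c d : T) (G H : rel T) : splits G H ->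
  uniq [:: a; b; c; d] -> F a b -> F b c -> F c d ->
  ~~ G a c -> ~~ G b d -> ~~ G a d -> paths_through H G b.
Proof.
move=> GH u Fab Fbc Fcd /negPf Gac /negPf Gbd /negPf Gad.
have [[sG sH] [iG _] E GF HF] := GH.
have Eab := path4_edges few u Fab Fbc Fcd.
apply: (@paths_through_hub T F H G _ b c d) => //.
- by move=> i j; rewrite andbC.
- move=> i j Gij; have ij : i != j by apply: contraTneq Gij => ->; rewrite iG.
  have /andP[] : (i \in [:: a; b; c; d]) && (j \in [:: a; b; c; d]).
    apply: (connect_in_edges symF) => //; first exact: GF.
    move=> x y /Eab.
    by rewrite !inE !xpair_eqE => /or4P[|||/or3P[]] /andP[/eqP-> _]; rewrite eqxx ?orbT.
  rewrite !inE => /or4P[] /eqP kE /or4P[] /eqP lE; subst i j; move: ij Gij;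
    rewrite ?eqxx ?(sG c a) ?(sG d a) ?(sG d b) ?Gac ?Gbd ?Gad //= => _ _;
    by rewrite // symF.
- move=> i j /Eab; rewrite !inE !xpair_eqE.
  by move=> /or4P[|||/or3P[]] /andP[/eqP-> /eqP->]; rewrite !eqxx ?orbT.
Qed.

(** Now [m], [a], [b] form a triangle of [G], so non-edges inside the component end at [c]. *)
Lemma star_extra (m a b c : T) (G H : rel T) : splits G H ->
  uniq [:: m; a; b; c] -> F m a -> F m b -> F m c -> G a b ->
  paths_through G H c.
Proof.
move=> GH u Fma Fmb Fmc Gab; have [[sG _] _ _ _ HF] := GH.
have FG := splits_sub GH.
apply: (paths_through_cover HF) => k l kl ckl.
have /andP[] : (k \in [:: m; a; b; c]) && (l \in [:: m; a; b; c]).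
  apply: (connect_in_edges symF) => // i j /(star_edges few u Fma Fmb Fmc).
  by rewrite !inE !xpair_eqE => /or4P[|||/or3P[]] /andP[/eqP-> _]; rewrite eqxx ?orbT.
have [Gma Gmb] : G m a /\ G m b by split; exact: FG.
rewrite !inE => /or4P[] /eqP kE /or4P[] /eqP lE; subst k l; move: kl;
  rewrite ?eqxx ?(sG a m) ?(sG b m) ?(sG b a) ?Gma ?Gmb ?Gab //=;
  by [left | right].
Qed.

Lemma star_sub (m a b c : T) (G H : rel T) : splits G H ->
  uniq [:: m; a; b; c] -> F m a -> F m b -> F m c ->
  ~~ G a b -> ~~ G a c -> ~~ G b c -> paths_through H G m.
Proof.
move=> GH u Fma Fmb Fmc /negPf Gab /negPf Gac /negPf Gbc.
have [[sG sH] [iG _] E GF HF] := GH.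
have Eab := star_edges few u Fma Fmb Fmc.
(* Every edge contains the centre [m]; the exceptional edge is filled with [m]--[a]. *)
apply: (@paths_through_hub T F H G _ m m a) => //.
- by move=> i j; rewrite andbC.
- move=> i j Gij; have ij : i != j by apply: contraTneq Gij => ->; rewrite iG.
  have /andP[] : (i \in [:: m; a; b; c]) && (j \in [:: m; a; b; c]).
    apply: (connect_in_edges symF) => //; first exact: GF.
    move=> x y /Eab.
    by rewrite !inE !xpair_eqE => /or4P[|||/or3P[]] /andP[/eqP-> _]; rewrite eqxx ?orbT.
  rewrite !inE => /or4P[] /eqP kE /or4P[] /eqP lE; subst i j; move: ij Gij;
    rewrite ?eqxx ?(sG b a) ?(sG c a) ?(sG c b) ?Gab ?Gac ?Gbc //= => _ _;
    by rewrite // symF.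
- move=> i j /Eab; rewrite !inE !xpair_eqE.
  by move=> /or4P[|||/or3P[]] /andP[/eqP-> /eqP->]; rewrite !eqxx ?orbT.
Qed.

(** Either [F] is a path on four vertices, or a star with three leaves, up to isolated vertices, or
    it contains neither. *)
Lemma splits_paths_through (v0 : T) (G H : rel T) : splits G H ->
  (exists v, paths_through G H v) \/ (exists v, paths_through H G v).
Proof.
move=> GH; have HG := splitsC GH; have [_ _ E GF HF] := GH.
have nE i j : ~~ F i j -> G i j -> ~~ H i j by move=> + Gij; rewrite -E Gij.
have [[a [b [c [d [u Fab Fbc Fcd]]]]]|noP4] := pselect (exists a b c d,
    [/\ uniq [:: a; b; c; d], F a b, F b c & F c d]).
  have ru : uniq [:: d; c; b; a] by rewrite -(rev_uniq [:: a; b; c; d]) in u.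
  have [Fba Fcb Fdc] : [/\ F b a, F c b & F d c].
    by rewrite !(symF b) !(symF d) (symF c) Fab.
  have [[sG sH] _ _ _ _] := GH.
  have [Gac|Gac] := boolP (G a c).
    by left; exists d; exact: path4_extra GH u Fab Fbc Fcd Gac.
  have [Gbd|Gbd] := boolP (G b d).
    left; exists a; apply: path4_extra GH ru Fdc Fcb Fba _.
    by rewrite sG.
  have [Hac|Hac] := boolP (H a c).
    by right; exists d; exact: path4_extra HG u Fab Fbc Fcd Hac.
  have [Hbd|Hbd] := boolP (H b d).
    right; exists a; apply: path4_extra HG ru Fdc Fcb Fba _.
    by rewrite sH.
  (* The only chord left is [a]--[d]. It is not in [F], so [G] and [H] cannot both have it, and one
     of them is the bare path. *)
  have [Gad|Gad] := boolP (G a d); last first.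
    by right; exists b; exact: path4_sub GH u Fab Fbc Fcd Gac Gbd Gad.
  left; exists b; apply: (path4_sub HG u Fab Fbc Fcd Hac Hbd).
  apply: nE Gad; apply/negP => /(path4_edges few u Fab Fbc Fcd).
  move: u; rewrite /= !inE !negb_or !xpair_eqE.
  move=> /and4P[/and3P[ab ac ad] /andP[bc bd] cd _].
  rewrite eqxx !(eq_sym d) (negPf ab) (negPf ac) (negPf ad) (negPf bd).
  by rewrite (negPf cd) /= ?andbF.
have [[m [a [b [c [u Fma Fmb Fmc]]]]]|noSt] := pselect (exists m a b c,
    [/\ uniq [:: m; a; b; c], F m a, F m b & F m c]).
  have u2 : uniq [:: m; a; c; b].
    by rewrite -(perm_uniq (_ : perm_eq [:: m; a; b; c] _)) //
      !perm_cons (perm_catC [:: b] [:: c]).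
  have u3 : uniq [:: m; b; c; a].
    by rewrite -(perm_uniq (_ : perm_eq [:: m; a; b; c] _)) //
      perm_cons (perm_catC [:: a] [:: b; c]).
  have [Gab|Gab] := boolP (G a b).
    by left; exists c; exact: star_extra GH u Fma Fmb Fmc Gab.
  have [Gac|Gac] := boolP (G a c).
    by left; exists b; exact: star_extra GH u2 Fma Fmc Fmb Gac.
  have [Gbc|Gbc] := boolP (G b c).
    by left; exists a; exact: star_extra GH u3 Fmb Fmc Fma Gbc.
  by right; exists m; exact: star_sub GH u Fma Fmb Fmc Gab Gac Gbc.
have {}noP4 a b c d : uniq [:: a; b; c; d] -> F a b -> F b c -> F c d -> False.
  by move=> *; apply: noP4; exists a, b, c, d.
have {}noSt a b c d : uniq [:: a; b; c; d] -> F a b -> F a c -> F a d -> False.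
  by move=> *; apply: noSt; exists a, b, c, d.
left.
(* If some connected pair is not adjacent in [F], its end [k] belongs to all such pairs. If there is
   none, any vertex [v0] will do. *)
have [[k [l [kl ckl Fkl]]]|noD] := pselect (exists k l,
    [/\ k != l, connect F k l & ~~ F k l]).
  have [m [Fkm Fml]] := connect_distance2 kl ckl Fkl noP4.
  exists k; apply: (paths_through_cover HF) => k' l' kl' ckl' Gkl'.
  have Fkl' : ~~ F k' l' by rewrite -E negb_and Gkl'.
  have [m' [Fkm' Fml']] := connect_distance2 kl' ckl' Fkl' noP4.
  by case: (distance2_meet symF irrF few noP4 noSt kl Fkl Fkm Fml
    kl' Fkl' Fkm' Fml') => ->;
    [left | right].
exists v0; apply: (paths_through_cover HF) => k l kl ckl Gkl.
by exfalso; apply: noD; exists k, l; split=> //; rewrite -E negb_and Gkl.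
Qed.

End FewCommonEdgesCover.

(** * Assembling the three cases *)

Lemma connected_at_most_one_path (R : realType) (n : nat) (G H : rel 'I_n) :
  at_most_one_path G H -> connected (double_markov R G H).
Proof.
by move=> one; apply: connected_star => S; exact: connected_one_path_to_1.
Qed.

Lemma connected_paths_through (R : realType) (n : nat) (G H : rel 'I_n)
    (v : 'I_n) :
  paths_through G H v -> connected (double_markov R G H).
Proof.
by move=> thru; apply: connected_star => S; exact: (connected_paths_through_to_1 thru).
Qed.

Lemma splits_common (n : nat) (G H : rel 'I_n) (F := common G H) :
  simple_graph G -> simple_graph H ->
  splits F (restrict_rel F G) (restrict_rel F H).
Proof.
move=> [sG iG] [sH iH].
have sF : symmetric F by move=> i j; rewrite /F /common /= sG sH.
have cF := sym_connect_sym sF.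
split; [split|split| | |].
- by move=> i j; rewrite /restrict_rel /= sG cF.
- by move=> i j; rewrite /restrict_rel /= sH cF.
- by move=> i; rewrite /restrict_rel /= iG.
- by move=> i; rewrite /restrict_rel /= iH.
- move=> i j; rewrite /restrict_rel /= andbACA andbb.
  rewrite -[G i j && H i j]/(F i j).
  by case Fij: (F i j); rewrite //= connect1.
- by move=> i j /andP[].
- by move=> i j /andP[].
Qed.

Lemma card_edges_common (n : nat) (G H : rel 'I_n) :
  (#|edges (common G H)| <= #|edges G :&: edges H|)%N.
Proof.
apply: subset_leq_card; apply/fintype.subsetP => e /imsetP[[i j]].
by rewrite inE => /andP[Gij Hij] ->; rewrite finset.in_setI !edge_mem.
Qed.

Theorem theorem3 (R : realType) (n : nat) (G H : rel 'I_n)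
  (hG : simple_graph G) (hH : simple_graph H) :
  [\/ at_most_one_path G H \/ at_most_one_path H G,
      (exists i : 'I_n, paths_through G H i) \/
      (exists i : 'I_n, paths_through H G i)
    | (#|edges G :&: edges H| <= 3)%N] ->
  connected (double_markov R G H).
Proof.
have through G' H' : (exists v : 'I_n, paths_through G' H' v) \/
    (exists v, paths_through H' G' v) -> connected (double_markov R G' H').
  move=> [] [v thru]; first exact: (connected_paths_through thru).
  exact/connected_double_markov_swap/(connected_paths_through thru).
move=> [[one|one]|thru|few].
- exact: connected_at_most_one_path.
- exact/connected_double_markov_swap/connected_at_most_one_path.
- exact: through.
(* With no vertices there is no [v] to offer, but the condition on unique paths holds vacuously. *)
have [v0 _|noV] := pickP (fun _ : 'I_n => true); last first.
  by apply: connected_at_most_one_path => k; have := noV k.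
rewrite double_markov_within; apply: through.
have [[sG iG] [sH _]] := (hG, hH).
apply: (@splits_paths_through _ (common G H)) => //.
- by move=> i j; rewrite /common /= sG sH.
- by move=> i; rewrite /common /= iG.
- exact: leq_trans (card_edges_common G H) few.
- exact: splits_common.
Qed.
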